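(* Let $\Omega\subset\mathbb R^2$ be a bounded open convex domain with nonempty interior and let $F$ be a nonnegative concave tropical series on $\Omega$, continuous on $\overline\Omega$ and equal to zero on $\partial\Omega$. Fix $$0<t<\max_{\overline\Omega}F,\qquad \Delta_t:=\{F\ge t\}.$$ Then the following hold (with no regular-value assumption on $t$). (i) Finite rational core. The set $\Delta_t$ is a compact convex polygon with rational slopes and nonempty interior. There exist an open neighborhood $U_t$ of $\Delta_t$ with $\overline{U_t}$ a compact subset of $\Omega$ and finitely many global integer-slope supporting monomials $L_1,\dots,L_M$ of $F$ such that $F=\min_{1\le j\le M}L_j$ on $U_t$. Consequently $H_t:=F-t$ is a nonnegative zero-boundary tropical polynomial on $\Delta_t$. (ii) Core gluing. Let $G$ be a nonnegative zero-boundary tropical polynomial on $\Delta_t$ satisfying $G\le H_t$. Then $$\widetilde F(x)=\begin{cases}t+G(x),&x\in\Delta_t,\\ F(x),&x\in\Omega\setminus\Delta_t\end{cases}$$ is a nonnegative concave tropical series on $\Omega$, continuous on $\overline\Omega$ and zero on $\partial\Omega$. (iii) Exact shifted relaxation. Assume in addition that $F=F_{\Omega,P}$ for a nonempty finite set $P\subset\Omega$, and let $C\subset\Omega$ be compact. Then $F>0$ throughout $\Omega$. For every $$0<t<\min_{x\in C\cup P}F(x),$$ $C\cup P$ is contained in the interior $\Delta_t^\circ$ and $$F=t+F_{\Delta_t,P}\qquad\text{on }\Delta_t .$$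
   Context: A tropical series on a bounded open convex set $U\subset\mathbb R^2$ is a function which near every point of $U$ has the form $F(x)=\min_{m\in A}(c_m+\langle m,x\rangle)$ with $A\subset\mathbb Z^2$ finite and $c_m\in\mathbb R$. Its corner locus $V(F)\subset U$ is the set of points where the minimum is attained by at least two distinct affine functions. For nonempty finite $P\subset\Omega$, $F_{\Omega,P}=G_P0_\Omega$ (tropical relaxation) is the pointwise infimum of all tropical series $G$ on $\Omega$ that are nonnegative, continuous on $\overline\Omega$, zero on $\partial\Omega$, and satisfy $P\subset V(G)$; it is itself such a series. For a compact convex polygon $\Delta$ with nonempty interior $\Delta^\circ$ and $P\subset\Delta^\circ$, $F_{\Delta,P}:\Delta\to\mathbb R$ is the relaxation defined in the same way with $\Delta^\circ$ in place of $\Omega$. A polygon has rational slopes if it is a finite intersection of half-planes with integer normal vectors. A nonnegative zero-boundary tropical polynomial on a compact polygon $\Delta$ is a function $\Delta\to\mathbb R_{\ge0}$ that vanishes on $\partial\Delta$ and is the minimum of finitely many affine functions with gradients in $\mathbb Z^2$. A global integer-slope supporting monomial of $F$ is an affine function $L$ with gradient in $\mathbb Z^2$ such that $L\ge F$ on $\Omega$ and $L(x)=F(x)$ for some $x\in\Omega$. *)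

(* Defs.v *)
From mathcomp Require Import all_boot all_order all_algebra.
From mathcomp Require Import all_classical all_reals all_analysis.

Set Implicit Arguments.
Unset Strict Implicit.
Unset Printing Implicit Defensive.

Import Order.TTheory GRing.Theory Num.Theory.
Import numFieldNormedType.Exports.

Local Open Scope classical_set_scope.
Local Open Scope ring_scope.

Definition pairing (R : realType) (m : 'rV[int]_2) (x : 'rV[R]_2) : R :=
  \sum_(i < 2) (m 0 i)%:~R * x 0 i.

(* [(m, c)] stands for the affine function [x |-> c + <m, x>]. *)
Definition monomial (R : realType) : Type := ('rV[int]_2 * R)%type.

Definition meval (R : realType) (L : monomial R) (x : 'rV[R]_2) : R :=
  L.2 + pairing L.1 x.

(* As the minimum is attained, this forces [Ls] to be nonempty. *)
Definition is_min_of (R : realType) (Ls : seq (monomial R)) (x : 'rV[R]_2)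
    (v : R) : Prop :=
  (exists2 L, L \in Ls & v = meval L x) /\
  (forall L, L \in Ls -> v <= meval L x).

Definition local_expansion (R : realType) (F : 'rV[R]_2 -> R) (x : 'rV[R]_2)
    (A : seq 'rV[int]_2) (c : 'rV[int]_2 -> R) : Prop :=
  \forall y \near x, is_min_of [seq (m, c m) | m <- A] y (F y).

Definition tropical_series (R : realType) (U : set 'rV[R]_2)
    (F : 'rV[R]_2 -> R) : Prop :=
  forall x, U x -> exists A c, local_expansion F x A c.

(* Whether the minimum is attained twice at [x] does not depend on the local
   expansion: if F is affine near [x], only the monomial equal to F there can
   attain the minimum at [x]. *)
Definition corner_locus (R : realType) (U : set 'rV[R]_2)
    (F : 'rV[R]_2 -> R) : set 'rV[R]_2 :=
  [set x | U x /\ exists A c, local_expansion F x A c /\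
    exists m1 m2, [/\ m1 \in A, m2 \in A, m1 <> m2,
      F x = meval (m1, c m1) x & F x = meval (m2, c m2) x]].

Definition boundary (R : realType) (A : set 'rV[R]_2) : set 'rV[R]_2 :=
  closure A `\` A°.

Definition concave_function (R : realType) (U : set 'rV[R]_2)
    (F : 'rV[R]_2 -> R) : Prop :=
  convex_function U (fun x => - F x).

(* Functions on the closure of [U] are represented by total functions whose
   values outside that closure are irrelevant. *)
Definition zero_boundary_series (R : realType) (U : set 'rV[R]_2)
    (F : 'rV[R]_2 -> R) : Prop :=
  [/\ tropical_series U F,
      (forall x, U x -> 0 <= F x),
      {within closure U, continuous F} &
      (forall x, boundary U x -> F x = 0)].

(* The infimum is taken in the extended reals, where the infimum of the empty
   set is +oo, rather than in [R], where [inf set0 = 0]. For a compact polygon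
   D, the relaxation on D is [relaxation D° P]. *)
Definition relaxation (R : realType) (U P : set 'rV[R]_2) (x : 'rV[R]_2) :
    \bar R :=
  ereal_inf [set (G x)%:E | G in
    [set G | zero_boundary_series U G /\ P `<=` corner_locus U G]].

Definition superlevel (R : realType) (U : set 'rV[R]_2) (F : 'rV[R]_2 -> R)
    (t : R) : set 'rV[R]_2 :=
  [set x | U x /\ t <= F x].

Definition rational_slopes (R : realType) (D : set 'rV[R]_2) : Prop :=
  exists hs : seq ('rV[int]_2 * R),
    (forall h, h \in hs -> h.1 <> 0) /\
    D = [set x | forall h, h \in hs -> h.2 <= pairing h.1 x].

Definition zero_boundary_polynomial (R : realType) (D : set 'rV[R]_2)
    (G : 'rV[R]_2 -> R) : Prop :=
  [/\ (forall x, D x -> 0 <= G x),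
      (forall x, boundary D x -> G x = 0) &
      (exists Ls : seq (monomial R), forall x, D x -> is_min_of Ls x (G x))].

Definition supporting_monomial (R : realType) (U : set 'rV[R]_2)
    (F : 'rV[R]_2 -> R) (L : monomial R) : Prop :=
  (forall x, U x -> F x <= meval L x) /\ (exists2 x, U x & meval L x = F x).

Definition core_gluing (R : realType) (D : set 'rV[R]_2) (t : R)
    (F G : 'rV[R]_2 -> R) (x : 'rV[R]_2) : R :=
  if x \in D then t + G x else F x.

(* Main.v *)
(** Everything rests on two facts about a concave tropical series F. A monomial
    active at one point is a global upper bound of F, so F is a minimum of
    finitely many global supporting monomials on any compact set. And if L >= 0
    on Delta = {F >= t} while L <= F - t at some point where F > t, then by
    concavity F <= t + L outside Delta. Hence gluing t + G into Delta amounts to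
    taking the minimum of F and the monomials t + L with L active for G at a
    point where G < F - t, and this formula is valid on all of Omega.

    For (iii), a competitor G on the interior of Delta may have infinitely many
    monomials, but those active where G < F - t are at least -t on Omega, so
    their integer gradients are bounded and they are finitely many; therefore
    min(F, t + G) extends by F to a competitor on Omega. That F itself is a
    competitor, i.e. has corners at P, follows from the integrality of slopes:
    a competitor with a corner at p cannot be arbitrarily close at p to a
    function below it which is affine near p with integer slope. *)

Require Import Defs.
From mathcomp Require Import all_boot all_order all_algebra finmap.
From mathcomp Require Import all_classical all_reals all_analysis.
From mathcomp Require Import ring lra.

Set Implicit Arguments.
Unset Strict Implicit.
Unset Printing Implicit Defensive.

Import Order.TTheory GRing.Theory Num.Theory.
Import numFieldNormedType.Exports.

Local Open Scope classical_set_scope.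
Local Open Scope ring_scope.

(** * Monomials and local minima *)

Lemma continuous_forP (R : realType) (f : 'rV[R]_2 -> R) (x : 'rV[R]_2) :
  {for x, continuous f} <->
  (forall e, 0 < e -> \forall y \near x, `|f x - f y| <= e).
Proof. exact: (@cvgrPdist_le R R^o _ (nbhs x)). Qed.

Lemma convex_setP (R : realType) (U : set 'rV[R]_2) :
  convex_set U <-> forall x y s, U x -> U y -> 0 <= s <= 1 ->
    U (s *: x + (1 - s) *: y).
Proof.
split=> [cU x y s Ux Uy s01|cU x y l /set_mem Ux /set_mem Uy]; last first.
  by apply/mem_set/cU => //; rewrite ge0 le1.
by have /= := cU x y (Itv01 (andP s01).1 (andP s01).2); rewrite !inE; exact.
Qed.

Lemma concave_functionP (R : realType) (U : set 'rV[R]_2)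
    (F : 'rV[R]_2 -> R) :
  concave_function U F <-> forall x y s, U x -> U y -> 0 <= s <= 1 ->
    s * F x + (1 - s) * F y <= F (s *: x + (1 - s) *: y).
Proof.
have E a b c d : (- a <= b * - c + (1 - b) * - d) =
    (b * c + (1 - b) * d <= a :> R).
  by rewrite !mulrN -opprD lerN2.
split=> [cF x y s Ux Uy s01|cF l x y /set_mem Ux /set_mem Uy].
  have := cF (Itv01 (andP s01).1 (andP s01).2) x y (mem_set Ux) (mem_set Uy).
  by rewrite -E.
by have := cF x y l%:num Ux Uy; rewrite -E ge0 le1; exact.
Qed.

Lemma pairing2 (R : realType) (m : 'rV[int]_2) (x : 'rV[R]_2) :
  pairing m x = (m 0 0)%:~R * x 0 0 + (m 0 1)%:~R * x 0 1.
Proof.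
rewrite /pairing !big_ord_recl big_ord0 addr0.
by congr (_ + (m 0 _)%:~R * x 0 _); apply/val_inj.
Qed.

Lemma meval_convex (R : realType) (L : monomial R) (x y : 'rV[R]_2) (s : R) :
  meval L (s *: x + (1 - s) *: y) = s * meval L x + (1 - s) * meval L y.
Proof. by rewrite /meval !pairing2 !mxE; ring. Qed.

Lemma meval_continuous (R : realType) (L : monomial R) : continuous (meval L).
Proof.
have E : meval L =
    fun y => L.2 + ((L.1 0 0)%:~R * y 0 0 + (L.1 0 1)%:~R * y 0 1).
  by apply/funext => y; rewrite /meval pairing2.
rewrite E => x.
have c i :
    {for x, continuous (fun y : 'rV[R]_2 => (L.1 0 i)%:~R * y 0 i : R)}.
  by apply: continuousM; [exact: cst_continuous|exact: coord_continuous].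
have cc : {for x, continuous (fun=> L.2 : R)} by exact: cst_continuous.
exact: continuousD cc (continuousD (c 0) (c 1)).
Qed.

Definition shift_monomial (R : realType) (t : R) (L : monomial R) :
    monomial R :=
  (L.1, t + L.2).

Lemma meval_shift (R : realType) (t : R) (L : monomial R) (x : 'rV[R]_2) :
  meval (shift_monomial t L) x = t + meval L x.
Proof. by rewrite /meval addrA. Qed.

Lemma is_min_of_shift (R : realType) (t : R) (Ls : seq (monomial R))
    (x : 'rV[R]_2) (v : R) :
  is_min_of Ls x v -> is_min_of (map (shift_monomial t) Ls) x (t + v).
Proof.
move=> [[L LLs vL] vmin]; split=> [|_ /mapP[L' /vmin + ->]].
  by exists (shift_monomial t L); rewrite ?map_f// meval_shift vL.
by rewrite meval_shift lerD2l.
Qed.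

Lemma is_min_of_cat (R : realType) (L1 L2 : seq (monomial R))
    (x : 'rV[R]_2) (u v : R) :
  is_min_of L1 x u -> is_min_of L2 x v ->
  is_min_of (L1 ++ L2) x (Num.min u v).
Proof.
move=> [[A AL uA] umin] [[B BL vB] vmin]; split.
  case: (leP u v) => _; first by exists A => //; rewrite mem_cat AL.
  by exists B => //; rewrite mem_cat BL orbT.
by move=> L; rewrite mem_cat ge_min => /orP[/umin->|/vmin->//]; rewrite ?orbT.
Qed.

(** A local expansion carries one constant per slope, whereas lists built by concatenation may
    repeat a slope. Keeping the least constant for each slope does not change the minimum. *)
Lemma is_min_of_merge (R : realType) (Ls : seq (monomial R)) :
  exists (A : seq 'rV[int]_2) (c : 'rV[int]_2 -> R),
    (forall L, L \in Ls -> L.1 \in A /\ c L.1 <= L.2) /\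
    forall x v, is_min_of Ls x v -> is_min_of [seq (m, c m) | m <- A] x v.
Proof.
pose B (m : 'rV[int]_2) := [seq L.2 | L <- Ls & L.1 == m].
(* The initial value is an element of [B m] whenever [B m] is nonempty, so the minimum belongs to
   [B m]; the default [0] only serves slopes absent from [Ls]. *)
pose c m := \big[Num.min/head 0 (B m)]_(a <- B m) a.
have cB m a : a \in B m -> c m <= a.
  by move=> aB; rewrite /c; apply: ge_bigmin_seq aB _ => //.
have Bc m : B m != [::] -> c m \in B m.
  rewrite /c; case: (B m) => // a s _ /=.
  rewrite -[X in _ \in X]/(a :: s).
  have : forall r, {subset r <= a :: s} ->
      \big[Num.min/a]_(b <- r) b \in a :: s.
    elim=> [|b r IH] sub; first by rewrite big_nil mem_head.
    rewrite big_cons; case: leP => _; first by apply: sub; rewrite mem_head.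
    by apply: IH => d dr; apply: sub; rewrite inE dr orbT.
  by apply.
have inB L : L \in Ls -> L.2 \in B L.1.
  by move=> LLs; apply/mapP; exists L => //; rewrite mem_filter eqxx.
exists [seq L.1 | L <- Ls], c; split=> [L LLs|x v [[L LLs vL] vmin]].
  by rewrite map_f//; split=> //; apply/cB/inB.
have mm m : m \in [seq L.1 | L <- Ls] -> (m, c m) \in Ls.
  move=> /mapP[L' L'Ls ->]; have /Bc : B L'.1 != [::].
    by apply/eqP => B0; have := inB _ L'Ls; rewrite B0.
  move=> /mapP[M]; rewrite mem_filter => /andP[/eqP E MLs ->].
  by rewrite -E -surjective_pairing.
split=> [|_ /mapP[m mLs ->]]; last by apply: vmin; exact: mm.
exists (L.1, c L.1); first by apply/mapP; exists L.1 => //; rewrite map_f.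
apply/eqP; rewrite eq_le vmin/=; last by rewrite mm ?map_f.
by rewrite vL /meval/= lerD2r cB ?inB.
Qed.

Lemma local_expansion_of_list (R : realType) (F : 'rV[R]_2 -> R)
    (x : 'rV[R]_2) (Ls : seq (monomial R)) :
  (\forall y \near x, is_min_of Ls y (F y)) ->
  exists A c, local_expansion F x A c.
Proof.
move=> FLs; have [A [c [_ mrg]]] := is_min_of_merge Ls.
by exists A, c; near=> y; apply: mrg; near: y.
Unshelve. all: by end_near. Qed.

Lemma corner_locus_of_list (R : realType) (U : set 'rV[R]_2)
    (F : 'rV[R]_2 -> R) (x : 'rV[R]_2) (Ls : seq (monomial R))
    (L1 L2 : monomial R) :
  U x -> (\forall y \near x, is_min_of Ls y (F y)) ->
  L1 \in Ls -> L2 \in Ls -> L1.1 <> L2.1 ->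
  F x = meval L1 x -> F x = meval L2 x -> corner_locus U F x.
Proof.
move=> Ux FLs L1s L2s L12 F1 F2; split=> //.
have [A [c [inA mrg]]] := is_min_of_merge Ls.
have FA : local_expansion F x A c by near=> y; apply: mrg; near: y.
exists A, c; split=> //; exists L1.1, L2.1.
have [_ Fmin] := nbhs_singleton FA.
(* A monomial attaining [F x] survives merging: the merged one of the same slope lies below it, but
   not below [F x]. *)
have E L : L \in Ls -> F x = meval L x -> F x = meval (L.1, c L.1) x.
  move=> /inA[mA cL] FL; apply/eqP; rewrite eq_le Fmin ?map_f//=.
  by rewrite FL /meval lerD2r.
by split=> //; [apply: (inA _ _).1|apply: (inA _ _).1|exact: E|exact: E].
Unshelve. all: by end_near. Qed.

Lemma near_all_seq (T : Type) (G : set_system T) {FG : Filter G} (I : eqType)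
    (s : seq I) (P : I -> T -> Prop) :
  (forall i, i \in s -> \forall y \near G, P i y) ->
  \forall y \near G, forall i, i \in s -> P i y.
Proof.
elim: s => [|i s IH] sP; first by near=> y.
near=> y => j; rewrite inE => /orP[/eqP->|]; last first.
  by move: j; near: y; apply: IH => k ks; apply: sP; rewrite inE ks orbT.
by near: y; apply: sP; exact: mem_head.
Unshelve. all: by end_near. Qed.

(** The monomial active at one of two nearby points bounds F from above at the other, and all
    monomials of the finite list vary by at most [e]. *)
Lemma is_min_of_continuous (R : realType) (F : 'rV[R]_2 -> R) (x : 'rV[R]_2)
    (Ls : seq (monomial R)) :
  (\forall y \near x, is_min_of Ls y (F y)) -> {for x, continuous F}.
Proof.
move=> FLs; apply/continuous_forP => e e0.
have Le : \forall y \near x, forall L, L \in Ls ->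
    `|meval L x - meval L y| <= e.
  apply: (near_all_seq (G := nbhs x)) => L _.
  by apply: (continuous_forP _ _).1 => //; exact: meval_continuous.
near=> y.
have [[L LLs FL] Fmin] : is_min_of Ls x (F x) by exact: nbhs_singleton FLs.
have [[L' L'Ls FL'] Fmin'] : is_min_of Ls y (F y) by near: y.
have Ley : forall L, L \in Ls -> `|meval L x - meval L y| <= e by near: y.
have := Fmin _ L'Ls; have := Fmin' _ LLs.
have := Ley _ LLs; have := Ley _ L'Ls; rewrite !ler_norml.
rewrite -FL -FL' => /andP[? ?] /andP[? ?] ? ?; apply/andP; split; lra.
Unshelve. all: by end_near. Qed.

Lemma tropical_series_continuous (R : realType) (U : set 'rV[R]_2)
    (F : 'rV[R]_2 -> R) (x : 'rV[R]_2) :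
  tropical_series U F -> U x -> {for x, continuous F}.
Proof. by move=> FU /FU[A [c]] /is_min_of_continuous. Qed.

(** * Concavity of tropical series *)

Lemma segment_continuous (R : realType) (x y : 'rV[R]_2) :
  continuous (fun u : R => u *: x + (1 - u) *: y).
Proof.
have -> : (fun u : R => u *: x + (1 - u) *: y) = (fun u => u *: (x - y) + y).
  by apply/funext => u; rewrite scalerBl scalerBr scale1r addrA addrAC.
move=> u; apply: (@continuousD R 'rV[R]_2 R (fun u => u *: (x - y)) (cst y)).
  exact: scalel_continuous.
exact: cst_continuous.
Qed.

Lemma ball_rV2P (R : realType) (x y : 'rV[R]_2) (r : R) : 0 < r ->
  ball x r y <-> forall i, `|x 0 i - y 0 i| < r.
Proof.
move=> r0; split=> [[_ xy] i|xy]; first exact: xy.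
by split=> // i j; rewrite ord1; exact: xy.
Qed.

(** Moving from [p] by [r / 2] along coordinate [i], against the sign of the slope, stays in the
    sup-norm ball and lowers [L] by the left-hand side. *)
Lemma meval_slope_bound (R : realType) (L : monomial R) (p : 'rV[R]_2)
    (r b : R) (i : 'I_2) :
  0 < r -> (forall y, ball p r y -> - b <= meval L y) ->
  `|(L.1 0 i)%:~R| * (r / 2) <= meval L p + b.
Proof.
move=> r0 Lb; set m : R := (L.1 0 i)%:~R.
pose y : 'rV[R]_2 := \row_j (p 0 j - if j == i then Num.sg m * (r / 2) else 0).
have /Lb : ball p r y.
  apply/ball_rV2P => // j; rewrite mxE opprB addrC subrK.
  case: ifP => _; last by rewrite normr0.
  rewrite normrM (@gtr0_norm _ (r / 2)) ?divr_gt0//.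
  have := normr_sg m; case: eqP => _ /= ->; lra.
have -> : meval L y = meval L p - `|m| * (r / 2); last by lra.
rewrite normrEsg /meval /pairing (bigD1 i)//= [in RHS](bigD1 i)//= !mxE eqxx.
rewrite (eq_bigr (fun j => (L.1 0 j)%:~R * p 0 j)); last first.
  by move=> j ji; rewrite mxE (negPf ji) subr0.
rewrite -/m; ring.
Qed.

Lemma meval_midpoint (R : realType) (L : monomial R) (x y : 'rV[R]_2)
    (u d : R) :
  let z v := v *: x + (1 - v) *: y in
  2 * meval L (z u) = meval L (z (u + d)) + meval L (z (u - d)).
Proof. by rewrite /= !meval_convex; ring. Qed.

(* Concavity is a local property: otherwise, along some segment, F minus the
   chord plus a small multiple of u(1-u) would attain a negative minimum at an
   interior point, near which it is strictly concave. *)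
Lemma tropical_series_concave (R : realType) (U : set 'rV[R]_2)
    (F : 'rV[R]_2 -> R) :
  convex_set U -> tropical_series U F -> concave_function U F.
Proof.
move=> /convex_setP cU FU; apply/concave_functionP => x y s Ux Uy s01.
pose z (u : R) := u *: x + (1 - u) *: y.
have zU u : 0 <= u <= 1 -> U (z u) by exact: cU.
pose h u := F (z u) - u * F x - (1 - u) * F y.
have -> : s * F x + (1 - s) * F y <= F (z s) = (0 <= h s).
  by rewrite /h -addrA -opprD subr_ge0.
rewrite leNgt; apply/negP => hs0.
(* Since [s * (1 - s) <= 1], the perturbation adds at most half of [- h s], so that [k s] stays
   negative. *)
pose e := - h s / 2.
pose k u := h u + e * (u * (1 - u)).
have z0 : z 0 = y by rewrite /z scale0r add0r subr0 scale1r.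
have z1 : z 1 = x by rewrite /z subrr scale0r addr0 scale1r.
have k0 : k 0 = 0 by rewrite /k /h z0; ring.
have k1 : k 1 = 0 by rewrite /k /h z1; ring.
have e0 : 0 < e by rewrite /e; lra.
have ks : k s < 0.
  have : s * (1 - s) <= 1 by nra.
  by rewrite /k /e; nra.
have kc : {within `[0, 1], continuous k}.
  apply: continuous_in_subspaceT => u; rewrite inE/= in_itv/= => u01.
  pose q : {poly R} := e *: ('X * (1 - 'X)) - F x *: 'X - F y *: (1 - 'X).
  have -> : k = (fun u => F (z u)) + horner q.
    by apply/funext => v; rewrite /k /h fctE /q !hornerE /=; ring.
  apply: continuousD; last exact: continuous_horner.
  apply: (@continuous_comp _ _ _ z F); first exact: segment_continuous.
  exact: tropical_series_continuous FU (zU _ u01).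
have [c] := EVT_min ler01 kc.
rewrite in_itv/= => /andP[c0 c1] kmin.
have kc0 : k c < 0.
  by apply: le_lt_trans ks; apply: kmin; rewrite in_itv/=.
have {}c0 : 0 < c.
  by rewrite lt_neqAle c0 andbT; apply/eqP => E; move: kc0; rewrite -E k0 ltxx.
have {}c1 : c < 1.
  by rewrite lt_neqAle c1 andbT; apply/eqP => E; move: kc0; rewrite E k1 ltxx.
have [A [a /segment_continuous/nbhs_ballP[r /= r0 rA]]] :
  exists A a, local_expansion F (z c) A a by apply: FU; apply: zU; rewrite !ltW.
(* Both [c + d] and [c - d] must lie in the unit interval and in the ball where the local expansion
   holds. *)
pose d := Num.min (r / 2) (Num.min (c / 2) ((1 - c) / 2)).
have d0 : 0 < d by rewrite !lt_min !divr_gt0 ?subr_gt0.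
have dr : d < r by rewrite !gt_min; apply/orP; left; lra.
have dc : d <= c / 2 by rewrite !ge_min lexx !orbT.
have dc1 : d <= (1 - c) / 2 by rewrite !ge_min lexx !orbT.
have Bc : ball c r c by exact: ballxx.
have Bp : ball c r (c + d).
  by rewrite /ball/= opprD addrA subrr sub0r normrN gtr0_norm.
have Bm : ball c r (c - d) by rewrite /ball/= opprB addrC subrK gtr0_norm.
have [[L LA FL] _] := rA _ Bc.
have [_ /(_ _ LA) Lp] := rA _ Bp.
have [_ /(_ _ LA) Lm] := rA _ Bm.
have Fmid : F (z (c + d)) + F (z (c - d)) <= 2 * F (z c).
  have E : 2 * meval L (z c) = meval L (z (c + d)) + meval L (z (c - d)).
    exact: meval_midpoint.
  by rewrite FL E; apply: lerD; [exact: Lp|exact: Lm].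
have kp : k c <= k (c + d).
  by apply: kmin; rewrite in_itv/=; apply/andP; split; lra.
have km : k c <= k (c - d).
  by apply: kmin; rewrite in_itv/=; apply/andP; split; lra.
(* The linear terms cancel and the second difference of the quadratic term is [- 2 * (e * (d * d))];
   this contradicts the minimality expressed by [kp] and [km]. *)
have : k (c + d) + k (c - d) + 2 * (e * (d * d)) <= 2 * k c.
  by rewrite /k /h; lra.
have : 0 < e * (d * d) by rewrite mulr_gt0 // mulr_gt0.
lra.
Qed.

(** * Supporting monomials *)

(** On a short initial piece of the segment from [x] to [y], F lies above its chord and below [L].
    Both agree at [x], so the comparison carries over to [y]. *)
Lemma active_supporting (R : realType) (U : set 'rV[R]_2) (F : 'rV[R]_2 -> R)
    (x : 'rV[R]_2) (L : monomial R) :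
  concave_function U F -> U x -> (\forall y \near x, F y <= meval L y) ->
  F x = meval L x -> supporting_monomial U F L.
Proof.
move=> /concave_functionP cF Ux FL FLx; split=> [y Uy|]; last by exists x.
pose z (u : R) := u *: y + (1 - u) *: x.
have z0 : z 0 = x by rewrite /z scale0r add0r subr0 scale1r.
move: FL; rewrite -{1}z0 => /segment_continuous/nbhs_ballP[r /= r0 rL].
pose u := Num.min (r / 2) 1.
have u0 : 0 < u by rewrite lt_min ltr01 divr_gt0.
have u1 : u <= 1 by rewrite ge_min lexx orbT.
have ur : u < r by rewrite gt_min; apply/orP; left; lra.
have /rL : ball 0 r u by rewrite /ball/= sub0r normrN gtr0_norm.
have := cF y x u Uy Ux; rewrite u1 ltW//= meval_convex FLx => /(_ isT).
move=> /le_trans/[apply]; rewrite lerD2r ler_pM2l//.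
Qed.

(** Monomials of a local expansion that are not active at [x] stay strictly above F near [x] by
    continuity, so they can be discarded; the remaining ones are global supports. *)
Lemma tropical_series_active (R : realType) (U : set 'rV[R]_2)
    (F : 'rV[R]_2 -> R) (x : 'rV[R]_2) :
  concave_function U F -> tropical_series U F -> U x ->
  exists Ls : seq (monomial R),
    (forall L, L \in Ls -> supporting_monomial U F L /\ meval L x = F x) /\
    \forall y \near x, is_min_of Ls y (F y).
Proof.
move=> cF FU Ux; have [A [c FA]] := FU x Ux.
have Fc := is_min_of_continuous FA.
set Ls := [seq (m, c m) | m <- A] in FA.
have strict : \forall y \near x, forall L, L \in Ls ->
    F x <> meval L x -> F y < meval L y.
  apply: (near_all_seq (G := nbhs x)) => L LLs.
  have [->|/eqP FL] := eqVneq (F x) (meval L x); first by near=> y.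
  have FLx : F x < meval L x.
    by rewrite lt_neqAle; apply/andP; split;
      [exact/eqP|exact: (nbhs_singleton FA).2].
  pose e := (meval L x - F x) / 3.
  have e0 : 0 < e by rewrite divr_gt0 ?subr_gt0.
  near=> y.
  have : `|F x - F y| <= e by near: y; exact: (continuous_forP _ _).1.
  have : `|meval L x - meval L y| <= e.
    by near: y; apply: (continuous_forP _ _).1 => //; exact: meval_continuous.
  by rewrite !ler_norml /e => /andP[? ?] /andP[? ?] _; lra.
exists [seq L <- Ls | F x == meval L x]; split=> [L|].
  rewrite mem_filter => /andP[/eqP FL LLs]; split=> //.
  apply: active_supporting cF Ux _ FL.
  by near=> y; have [_] : is_min_of Ls y (F y) by [near: y]; exact.
near=> y.
have [[L LLs FL] Fmin] : is_min_of Ls y (F y) by near: y.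
have sy : forall L, L \in Ls -> F x <> meval L x -> F y < meval L y by near: y.
split=> [|M]; last by rewrite mem_filter => /andP[_ /Fmin].
exists L => //; rewrite mem_filter LLs andbT; apply/negPn/negP => /eqP FxL.
by have := sy _ LLs FxL; rewrite FL ltxx.
Unshelve. all: by end_near. Qed.

(** Cover [K] by the interiors of the sets on which a given list of supporting monomials computes F.
    The lists of a finite subcover can be concatenated, because each of their monomials bounds F
    from above on all of [U]. *)
Lemma compact_supporting (R : realType) (U K : set 'rV[R]_2)
    (F : 'rV[R]_2 -> R) :
  concave_function U F -> tropical_series U F -> compact K -> K `<=` U ->
  exists Ls : seq (monomial R),
    (forall L, L \in Ls -> supporting_monomial U F L) /\
    forall x, K x -> is_min_of Ls x (F x).
Proof.
move=> cF FU cK KU.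
have := cK; rewrite compact_cover => /(_ (seq (monomial R))
  (fun Ls : seq (monomial R) => forall L, L \in Ls -> supporting_monomial U F L)
  (fun Ls => [set x | is_min_of Ls x (F x)]°)).
case=> [Ls _||D DS KD]; first exact: open_interior.
  move=> x Kx.
  have [Ls [LsS LsF]] := tropical_series_active cF FU (KU _ Kx).
  by exists Ls => //= L /LsS[].
exists (flatten (enum_fset D)); split=> [L /flattenP[Ls LsD LLs]|x Kx].
  by have /set_mem := DS _ LsD; exact.
have [Ls LsD /interior_subset[[L LLs FL] Fmin]] := KD _ Kx.
split; first by exists L => //; apply/flattenP; exists Ls.
move=> M /flattenP[Ls' Ls'D MLs']; have /set_mem := DS _ Ls'D.
by move=> /(_ _ MLs')[+ _]; apply; exact: KU.
Qed.

(** * Superlevel sets and gluing *)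

(** A limit point outside [U] would be a boundary point, where F vanishes, although continuity up to
    the boundary gives [F x >= t > 0]. *)
Lemma superlevel_compact (R : realType) (U : set 'rV[R]_2) (F : 'rV[R]_2 -> R)
    (t : R) :
  bounded_set U -> open U -> zero_boundary_series U F -> 0 < t ->
  compact (superlevel U F t).
Proof.
move=> bU oU [_ _ cF F0] t0; apply: bounded_closed_compact.
  case: bU => M [Mr MU]; exists M; split=> // r /MU rU x [Ux _]; exact: rU.
move=> x clx.
have Ux : closure U x by apply: closure_subset clx => y [].
have tF : t <= F x.
  rewrite leNgt; apply/negP => Ft.
  have /cvgr_lt/(_ _ Ft) FW : F y @[y --> within (closure U) (nbhs x)] --> F x.
    by move/subspace_continuousP : cF; apply.
  have [y [[Uy ty] /(_ (subset_closure Uy))]] := clx _ FW.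
  by rewrite ltNge ty.
split=> //; apply: contrapT => nUx; have : boundary U x.
  by split=> // /interior_subset.
by move=> /F0 Fx0; move: tF; rewrite Fx0 leNgt t0.
Qed.

Lemma superlevel_convex (R : realType) (U : set 'rV[R]_2) (F : 'rV[R]_2 -> R)
    (t : R) :
  convex_set U -> concave_function U F -> convex_set (superlevel U F t).
Proof.
move=> /convex_setP cU /concave_functionP cF; apply/convex_setP.
move=> x y s [Ux tx] [Uy ty] s01; split; first exact: cU.
apply: le_trans (cF _ _ _ Ux Uy s01).
case/andP: s01 => s0 s1; nra.
Qed.

Lemma superlevel_interior (R : realType) (U : set 'rV[R]_2)
    (F : 'rV[R]_2 -> R) (t : R) (x : 'rV[R]_2) :
  open U -> tropical_series U F -> U x -> t < F x -> (superlevel U F t)° x.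
Proof.
move=> oU FU Ux tF; rewrite /interior.
have d0 : 0 < F x - t by rewrite subr_gt0.
have := (continuous_forP _ _).1 (tropical_series_continuous FU Ux) _ d0.
move=> Fd; near=> y; split; first by near: y; exact: open_nbhs_nbhs.
have : `|F x - F y| <= F x - t by near: y.
by rewrite ler_norml => /andP[_]; lra.
Unshelve. all: by end_near. Qed.

(* By concavity, the zero of L on the segment from z to y would otherwise be
   passed while F is still at least t. *)
Lemma concave_le_outside (R : realType) (U : set 'rV[R]_2)
    (F : 'rV[R]_2 -> R) (t : R) (L : monomial R) (z y : 'rV[R]_2) :
  convex_set U -> concave_function U F ->
  (forall x, superlevel U F t x -> 0 <= meval L x) ->
  U z -> t < F z -> meval L z <= F z - t ->
  U y -> F y < t -> F y <= t + meval L y.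
Proof.
move=> /convex_setP cU /concave_functionP cF L0 Uz tz Lz Uy ty.
rewrite leNgt; apply/negP => Fy.
pose a := F z - t; pose b := t - F y.
have a0 : 0 < a by rewrite subr_gt0.
have b0 : 0 < b by rewrite subr_gt0.
have ab0 : 0 < a + b by rewrite addr_gt0.
(* The weight at which the chord of F from [y] to [z] takes the value [t]; there the chord of [L] is
   negative. *)
pose s := b / (a + b).
have sE : 1 - s = a / (a + b) by rewrite /s; field; rewrite gt_eqF.
have s0 : 0 <= s by rewrite divr_ge0 // ltW.
have s1 : 0 <= 1 - s by rewrite sE divr_ge0 // ltW.
have s01 : 0 <= s <= 1 by rewrite s0; lra.
have /L0 : superlevel U F t (s *: z + (1 - s) *: y).
  split; first exact: cU.
  apply: le_trans (cF _ _ _ Uz Uy s01).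
  have -> : s * F z + (1 - s) * F y = t + (s * a - (1 - s) * b).
    by rewrite /a /b; ring.
  have -> : s * a = (1 - s) * b by rewrite sE /s; field; rewrite gt_eqF.
  by rewrite subrr addr0.
rewrite meval_convex leNgt; apply/negP; rewrite negbK.
have -> : s * meval L z + (1 - s) * meval L y =
    (b * meval L z + a * meval L y) / (a + b).
  by rewrite sE /s; field; rewrite gt_eqF.
rewrite pmulr_llt0 ?invr_gt0//.
have : b * meval L z <= b * a by rewrite ler_pM2l.
have : a * meval L y < a * (- b) by rewrite ltr_pM2l// /b; lra.
lra.
Qed.

(** The criterion shared by both gluings: on [U], [H] is the minimum of F and finitely many
    monomials, hence again a concave series. Its boundary behaviour is that of F, since the two
    agree off the closed set [K]. *)
Lemma glued_series (R : realType) (U K : set 'rV[R]_2) (F H : 'rV[R]_2 -> R)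
    (Ms : seq (monomial R)) :
  open U -> zero_boundary_series U F -> concave_function U F ->
  closed K -> K `<=` U -> (forall x, ~ K x -> H x = F x) ->
  (forall x, U x -> 0 <= H x) ->
  (forall x, U x -> [/\ H x <= F x, forall L, L \in Ms -> H x <= meval L x &
    H x = F x \/ exists2 L, L \in Ms & H x = meval L x]) ->
  zero_boundary_series U H /\ concave_function U H.
Proof.
move=> oU [FU _ cF F0] ccF cK KU HF H0 HM.
have HU : tropical_series U H.
  move=> x Ux; have [A [c FA]] := FU x Ux.
  apply: (@local_expansion_of_list _ _ _ ([seq (m, c m) | m <- A] ++ Ms)).
  near=> y.
  have Uy : U y by near: y; exact: open_nbhs_nbhs.
  have [[L LA FL] Fmin] : is_min_of [seq (m, c m) | m <- A] y (F y) by near: y.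
  have [HyF HyM Hy] := HM y Uy; split.
    case: Hy => [Hy|[M MMs Hy]]; last first.
      by exists M => //; rewrite mem_cat MMs orbT.
    by exists L; rewrite ?mem_cat ?LA// Hy.
  by move=> M; rewrite mem_cat => /orP[/Fmin|/HyM//]; exact: le_trans.
split; last first.
  apply/concave_functionP => x y s Ux Uy s01.
  have [s0 s1] : 0 <= s /\ 0 <= 1 - s by case/andP: s01; split; lra.
  have [HxF HxM _] := HM _ Ux; have [HyF HyM _] := HM _ Uy.
  have le2 a b : H x <= a -> H y <= b ->
      s * H x + (1 - s) * H y <= s * a + (1 - s) * b.
    by move=> ? ?; rewrite lerD// ler_wpM2l.
  (* A combination that leaves [U] also leaves [K], so [H] equals F there and concavity of F
     suffices. *)
  have [xy|nxy] := pselect (U (s *: x + (1 - s) *: y)); last first.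
    have -> : H (s *: x + (1 - s) *: y) = F (s *: x + (1 - s) *: y).
      by apply: HF => /KU.
    apply: le_trans ((concave_functionP _ _).1 ccF _ _ _ Ux Uy s01); exact: le2.
  have [_ _ [->|[M MMs ->]]] := HM _ xy.
    apply: le_trans ((concave_functionP _ _).1 ccF _ _ _ Ux Uy s01); exact: le2.
  by rewrite meval_convex; apply: le2; [exact: HxM|exact: HyM].
split=> // [|x bx].
  apply/subspace_continuousP => x Ux.
  have [Kx|nKx] := pselect (K x).
    apply: cvg_within_filter.
    exact: (tropical_series_continuous HU (KU _ Kx)).
  have Fx : F y @[y --> within (closure U) (nbhs x)] --> F x.
    by move/subspace_continuousP : cF; exact.
  change (H y @[y --> within (closure U) (nbhs x)] --> H x); rewrite HF//.
  move: Fx.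
  apply: cvg_trans; apply: near_eq_cvg; rewrite near_withinE.
  have : nbhs x (~` K).
    by apply: open_nbhs_nbhs; split=> //; exact: closed_openC.
  by apply: filterS => y nKy _; rewrite HF.
rewrite HF ?F0// => /KU Ux; case: bx => _; apply.
by move/interior_id : oU => ->.
Unshelve. all: by end_near. Qed.

(** Bounded integer slopes lie in a finite box, and each slope determines at most one element of
    [S]. *)
Lemma finite_monomials (R : realType) (S : set (monomial R)) (b : R) :
  (forall L, S L -> forall i, `|(L.1 0 i)%:~R : R| <= b) ->
  (forall L M, S L -> S M -> L.1 = M.1 -> L = M) ->
  exists Ms : seq (monomial R), forall L, L \in Ms <-> S L.
Proof.
move=> Sb Sinj.
pose N := Num.bound b.
pose ints := [seq Posz n | n <- iota 0 N] ++ [seq - Posz n | n <- iota 0 N].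
pose slopes : seq 'rV[int]_2 :=
  [seq \row_(j < 2) (if j == 0 then p else q) | p <- ints, q <- ints].
have intsP (a : int) : `|a%:~R : R| <= b -> a \in ints.
  move=> ab; have aN : (`|a| < N)%N.
    rewrite -(ltr_nat R) natr_absz intr_norm; apply: (le_lt_trans ab).
    by apply: archi_boundP; apply: le_trans ab.
  rewrite mem_cat; case: a ab aN => n _ aN.
    by apply/orP; left; apply/mapP; exists n; rewrite ?mem_iota.
  by apply/orP; right; apply/mapP; exists n.+1; rewrite ?mem_iota.
have slopesP L : S L -> L.1 \in slopes.
  move=> SL; have -> : L.1 = \row_(j < 2) (if j == 0 then L.1 0 0 else L.1 0 1).
    apply/rowP => j; rewrite mxE; case: eqP => [->//|j0].
    congr (L.1 0 _); apply/val_inj; case: j j0 => -[|[|//]] j1 // j0.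
    by case: j0; exact/val_inj.
  by apply: allpairs_f; apply: intsP; exact: Sb.
pose f (m : 'rV[int]_2) : option (monomial R) :=
  if pselect (exists2 L, S L & L.1 = m) is left e
  then Some (s2val (cid2 e)) else None.
exists (pmap f slopes) => L; rewrite mem_pmap; split=> [/mapP[m _]|SL].
  rewrite /f; case: pselect => // e [->]; exact: s2valP.
apply/mapP; exists L.1; first exact: slopesP.
rewrite /f; case: pselect => [e|[]]; last by exists L.
congr Some; apply: Sinj => //; first exact: s2valP.
by rewrite (s2valP' (cid2 e)).
Qed.

(** * Rational polygons and corners of the relaxation *)

(** The half-planes are [t <= L], for the nonconstant monomials computing F on the larger set
    [{F >= t / 2}]. That a point satisfying them lies in [U] at all follows by connectedness of the
    segment from [x0]. *)
Lemma superlevel_rational (R : realType) (U : set 'rV[R]_2) (F : 'rV[R]_2 -> R)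
    (t : R) (x0 : 'rV[R]_2) :
  bounded_set U -> open U -> zero_boundary_series U F -> concave_function U F ->
  0 < t -> U x0 -> t < F x0 -> rational_slopes (superlevel U F t).
Proof.
move=> bU oU ZF cF t0 Ux0 tx0; have [FU _ _ _] := ZF.
have t20 : 0 < t / 2 by rewrite divr_gt0.
have cD : compact (superlevel U F t) by exact: superlevel_compact.
have [Ls [LsS LsF]] := compact_supporting cF FU
  (superlevel_compact bU oU ZF t20) (fun x => @proj1 _ _).
exists [seq (L.1, t - L.2) | L <- Ls & L.1 != 0]; split.
  by move=> _ /mapP[L + ->]; rewrite mem_filter => /andP[/eqP].
apply/seteqP; split=> x; rewrite /mkset.
  move=> [Ux tx] _ /mapP[L + ->]; rewrite mem_filter => /andP[_ /LsS[FL _]] /=.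
  by rewrite lerBlDl; apply: le_trans tx _; exact: FL.
move=> hx.
have Lx L : L \in Ls -> t <= meval L x.
  (* A constant monomial gives no half-plane, but its value is at least [F x0 > t]. *)
  move=> LLs; have [L0|L0] := eqVneq L.1 0; last first.
    rewrite /meval -lerBlDl; apply: (hx (L.1, t - L.2)); apply/mapP.
    by exists L => //; rewrite mem_filter L0.
  have := (LsS _ LLs).1 _ Ux0.
  by rewrite /meval L0 !pairing2 !mxE !mul0r => ?; apply: le_trans (ltW tx0) _.
pose z (u : R) := u *: x + (1 - u) *: x0.
have z0 : z 0 = x0 by rewrite /z scale0r add0r subr0 scale1r.
have z1 : z 1 = x by rewrite /z subrr scale0r addr0 scale1r.
have zc : continuous z by exact: segment_continuous.
(* [B] is closed by compactness of the superlevel set. It is relatively open because, on the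
   segment, reaching level [t / 2] already forces level [t]: there F is a minimum of monomials that
   are at least [t] at both ends. *)
pose B := [set u | `[0, 1]%classic u /\ superlevel U F t (z u)].
suff BE : B = `[0, 1]%classic.
  have : B 1 by rewrite BE /= in_itv/= lexx ler01.
  by rewrite /B/= z1 => -[].
apply: segment_connected.
- exists 0; split; first by rewrite /= in_itv/= lexx ler01.
  by rewrite z0; split=> //; exact: ltW.
- exists (z @^-1` (superlevel U F (t / 2))°).
    by apply: open_comp => [u _|]; [exact: zc|exact: open_interior].
  apply/seteqP; split=> u [u01] /=.
    move=> [Uz tz]; split=> //; apply: superlevel_interior => //; lra.
  move=> /interior_subset Wz; split=> //; split; first exact: Wz.1.
  have [[L LLs ->] _] := LsF _ Wz.
  rewrite meval_convex; have := Lx _ LLs; have := (LsS _ LLs).1 _ Ux0.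
  by move: u01; rewrite /= in_itv/= => /andP[u0 u1]; nra.
- exists (z @^-1` (superlevel U F t)); last by apply/seteqP; split.
  apply: preimage_closed => //.
  by apply: compact_closed cD; exact: norm_hausdorff.
Qed.

(** A nonzero integer has absolute value at least 1, so the slope bound with lower bound 0
    applies. *)
Lemma meval_slope_gap (R : realType) (L : monomial R) (p : 'rV[R]_2) (r : R) :
  0 < r -> L.1 <> 0 -> (forall y, ball p r y -> 0 <= meval L y) ->
  r / 2 <= meval L p.
Proof.
move=> r0 L0 Lp.
have [i Li] : exists i, L.1 0 i != 0.
  apply: contra_notP L0 => /forallNP Li; apply/rowP => i; rewrite mxE.
  by have /negP := Li i; rewrite negbK => /eqP.
have := @meval_slope_bound _ L p r 0 i r0; rewrite oppr0 addr0 => /(_ Lp).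
apply: le_trans; rewrite ler_peMl ?(divr_ge0 (ltW r0))//.
by rewrite -intr_norm ler1z -gtz0_ge1 normr_gt0.
Qed.

(** One of two distinct active slopes is nonzero, and its monomial is nonnegative around [p]; the
    slope gap makes it positive at [p]. *)
Lemma corner_locus_gt0 (R : realType) (U : set 'rV[R]_2) (F : 'rV[R]_2 -> R)
    (p : 'rV[R]_2) :
  open U -> concave_function U F -> (forall x, U x -> 0 <= F x) ->
  corner_locus U F p -> 0 < F p.
Proof.
move=> oU cF F0 [Up [A [c [FA [m1 [m2 [m1A m2A m12 F1 F2]]]]]]].
have [m [mA m0 Fm]] : exists m, [/\ m \in A, m <> 0 & F p = meval (m, c m) p].
  have [m10|m10] := eqVneq m1 0; last by exists m1; split=> //; exact/eqP.
  by exists m2; split=> //; rewrite -m10; exact/nesym.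
have [FL _] : supporting_monomial U F (m, c m).
  apply: active_supporting cF Up _ Fm; near=> y.
  have [_] : is_min_of [seq (m, c m) | m <- A] y (F y) by near: y.
  by apply; rewrite map_f.
have [r /= r0 rU] : nbhs_ball p U by apply/nbhs_ballP; exact: open_nbhs_nbhs.
rewrite Fm; apply: lt_le_trans (_ : r / 2 <= _); first by rewrite divr_gt0.
apply: meval_slope_gap => // y /rU Uy; apply: le_trans (FL _ Uy); exact: F0.
Unshelve. all: by end_near. Qed.

(* If F had a single active monomial L0 at p, every competitor G would have an
   active monomial L with another slope and L >= L0 near p, so that the slope
   gap would keep G p away from F p. *)
Lemma relaxation_corner_locus (R : realType) (U P : set 'rV[R]_2)
    (F : 'rV[R]_2 -> R) :
  open U -> convex_set U -> tropical_series U F -> P `<=` U ->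
  (forall x, U x -> (F x)%:E = relaxation U P x) -> P `<=` corner_locus U F.
Proof.
move=> oU cU FU PU Frel p Pp; have Up := PU _ Pp.
have Fle G : zero_boundary_series U G -> P `<=` corner_locus U G ->
    forall x, U x -> F x <= G x.
  move=> ZG PG x Ux; rewrite -lee_fin Frel//; apply: ereal_inf_lbound.
  by exists G.
have [A [c FA]] := FU p Up.
have [[_ /mapP[m0 m0A ->] F0] Fmin] := nbhs_singleton FA.
apply: contrapT => nC.
have act m : m \in A -> F p = meval (m, c m) p -> m = m0.
  move=> mA Fm; apply: contrapT => mm0; apply: nC; split=> //.
  by exists A, c; split=> //; exists m, m0.
have FL0 : \forall y \near p, F y = meval (m0, c m0) y.
  have strict : \forall y \near p, forall m, m \in A -> m <> m0 ->
      meval (m0, c m0) y < meval (m, c m) y.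
    apply: (near_all_seq (G := nbhs p)) => m mA.
    have [->|/eqP mm0] := eqVneq m m0; first by near=> y.
    pose e := (meval (m, c m) p - meval (m0, c m0) p) / 3.
    have e0 : 0 < e.
      rewrite divr_gt0// subr_gt0 -F0 lt_neqAle Fmin ?map_f// andbT.
      by apply/eqP => Fm; apply: mm0; exact: act.
    near=> y.
    have : `|meval (m, c m) p - meval (m, c m) y| <= e.
      by near: y; apply: (continuous_forP _ _).1 => //; exact: meval_continuous.
    have : `|meval (m0, c m0) p - meval (m0, c m0) y| <= e.
      by near: y; apply: (continuous_forP _ _).1 => //; exact: meval_continuous.
    by move: (e0); rewrite !ler_norml /e => ? /andP[? ?] /andP[? ?] _; lra.
  near=> y.
  have [[_ /mapP[m mA ->] Fm] Fy] :
    is_min_of [seq (m, c m) | m <- A] y (F y) by near: y.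
  have sy : forall m, m \in A -> m <> m0 ->
    meval (m0, c m0) y < meval (m, c m) y by near: y.
  have [mm0|/eqP mm0] := eqVneq m m0; first by rewrite Fm mm0.
  have := sy _ mA mm0; rewrite -Fm ltNge => /negP[].
  by apply: Fy; rewrite map_f.
have [r /= r0 rU] : nbhs_ball p [set y | U y /\ F y = meval (m0, c m0) y].
  apply/nbhs_ballP; near=> y; split; last by near: y.
  by near: y; exact: open_nbhs_nbhs.
have : (relaxation U P p < (F p + r / 2)%:E)%E.
  by rewrite -Frel// lte_fin ltrDl divr_gt0.
move=> /ereal_inf_lt[_ [G [ZG PG] <-]]; rewrite lte_fin => Gp.
have [_ [B [d [GB [m1 [m2 [m1B m2B m12 G1 G2]]]]]]] := PG _ Pp.
have [m [mB mm0 Gm]] : exists m, [/\ m \in B, m <> m0 & G p = meval (m, d m) p].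
  have [m10|m10] := eqVneq m1 m0; last by exists m1; split=> //; exact/eqP.
  by exists m2; split=> //; rewrite -m10; exact/nesym.
have [GL _] : supporting_monomial U G (m, d m).
  have [GU _ _ _] := ZG.
  apply: active_supporting (tropical_series_concave cU GU) Up _ Gm; near=> y.
  have [_] : is_min_of [seq (m, d m) | m <- B] y (G y) by near: y.
  by apply; rewrite map_f.
(* [L] has nonzero integer slope and is nonnegative where F is affine, so [L] is at least [r / 2] at
   [p], against the choice of [G]. *)
pose L : monomial R := (m - m0, d m - c m0).
have LE y : meval L y = meval (m, d m) y - meval (m0, c m0) y.
  by rewrite /meval !pairing2 /= !mxE !intrD !intrN; ring.
have : r / 2 <= meval L p.
  apply: meval_slope_gap => // [/subr0_eq//|y /rU[Uy Fy]].
  rewrite LE -Fy subr_ge0; apply: le_trans (GL _ Uy); exact: Fle.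
rewrite LE -F0 -Gm; lra.
Unshelve. all: by end_near. Qed.

(** As [U] is open, the segment from [p] to [x] extends slightly beyond [x]; so [x] is a combination
    of [p], with positive weight, and a point where F is nonnegative. *)
Lemma concave_gt0 (R : realType) (U : set 'rV[R]_2) (F : 'rV[R]_2 -> R)
    (p : 'rV[R]_2) :
  open U -> concave_function U F -> (forall x, U x -> 0 <= F x) ->
  U p -> 0 < F p -> forall x, U x -> 0 < F x.
Proof.
move=> oU /concave_functionP cF F0 Up Fp x Ux.
pose z (u : R) := u *: p + (1 - u) *: x.
have z0 : z 0 = x by rewrite /z scale0r add0r subr0 scale1r.
have : nbhs (z 0) U by rewrite z0; exact: open_nbhs_nbhs.
move=> /segment_continuous/nbhs_ballP[r /= r0 rU].
pose u := r / 2.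
have u0 : 0 < u by rewrite divr_gt0.
have Uz : U (z (- u)).
  by apply: rU; rewrite /ball/= sub0r opprK gtr0_norm// /u; lra.
pose s := u / (1 + u).
have pu : 0 < 1 + u by rewrite addr_gt0 ?ltr01.
have s0 : 0 < s by rewrite divr_gt0.
have sE : 1 - s = 1 / (1 + u) by rewrite /s; field; rewrite gt_eqF.
have s1 : 0 <= 1 - s by rewrite sE divr_ge0// ltW.
have -> : x = s *: p + (1 - s) *: z (- u).
  rewrite sE /s /z; apply/rowP => i; rewrite !mxE.
  by field; rewrite gt_eqF.
apply: lt_le_trans (cF _ _ _ Up Uz _); last by rewrite ltW//=; lra.
by apply: ltr_pwDl; [exact: mulr_gt0|apply: mulr_ge0 => //; exact: F0].
Qed.

(** * Gluing competitors on a superlevel set *)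

Lemma compact_uniform_ball (R : realType) (U K : set 'rV[R]_2) :
  open U -> compact K -> K `<=` U ->
  exists2 r : R, 0 < r & forall x, K x -> ball x r `<=` U.
Proof.
move=> oU /compact_near_coveringP cK KU.
have : \forall r \near 0^'+, K `<=` (fun x : 'rV[R]_2 => ball x r `<=` U).
  apply: cK => x /KU Ux.
  have [r /= r0 rU] : nbhs_ball x U by apply/nbhs_ballP; exact: open_nbhs_nbhs.
  have r20 : 0 < r / 2 by rewrite divr_gt0.
  (* Halving the radius leaves room for balls around every center near [x]. *)
  exists (ball x (r / 2), [set s | 0 < s < r / 2]) => /=.
    split; first exact: nbhsx_ballx.
    near=> s; apply/andP; split; near: s.
      exact: nbhs_right_gt.
    exact: nbhs_right_lt.
  move=> [y s] [/= xy /andP[s0 sr]] w yw; apply: rU.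
  rewrite [r]splitr; apply: ball_triangle xy _.
  exact: le_ball (ltW sr) _ yw.
move=> H; have [r [r0 rK]] : exists r : R, 0 < r /\
    K `<=` (fun x : 'rV[R]_2 => ball x r `<=` U).
  near (0 : R)^'+ => r; exists r; split; near: r => //; exact: nbhs_right_gt.
by exists r.
Unshelve. all: by end_near. Qed.

Lemma superlevel_bounded_above (R : realType) (U : set 'rV[R]_2)
    (F : 'rV[R]_2 -> R) (t : R) :
  bounded_set U -> open U -> zero_boundary_series U F -> 0 < t ->
  exists b, forall x, U x -> F x <= b.
Proof.
move=> bU oU ZF t0; have [FU _ _ _] := ZF.
have cD := superlevel_compact bU oU ZF t0.
have : \forall b \near +oo, superlevel U F t `<=` (fun x => F x <= b).
  move/compact_near_coveringP : cD; apply=> x [Ux _].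
  have := (continuous_forP _ _).1 (tropical_series_continuous FU Ux) _ ltr01.
  move=> Fd; exists ([set y | `|F x - F y| <= 1], [set b | F x + 1 <= b]) => /=.
    by split=> //; apply: nbhs_pinfty_ge; exact: num_real.
  by move=> [y b] /= [+ ?]; rewrite ler_norml => /andP[? _]; lra.
move=> H; have [b [tb Db]] : exists b, t <= b /\
    superlevel U F t `<=` (fun x => F x <= b).
  near +oo_R => b; exists b; split; near: b => //.
  apply: nbhs_pinfty_ge; exact: num_real.
exists b => x Ux; have [tF|/ltW Ft] := leP t (F x); first exact: Db.
exact: le_trans tb.
Unshelve. all: by end_near. Qed.

(** Moving slightly towards [x0] makes F strictly larger than [t], by concavity. *)
Lemma superlevel_closure_interior (R : realType) (U : set 'rV[R]_2)
    (F : 'rV[R]_2 -> R) (t : R) (x0 : 'rV[R]_2) :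
  open U -> convex_set U -> tropical_series U F -> concave_function U F ->
  U x0 -> t < F x0 -> superlevel U F t `<=` closure (superlevel U F t)°.
Proof.
move=> oU /convex_setP cU FU /concave_functionP cF Ux0 tx0 x [Ux tx] B.
pose z (u : R) := u *: x0 + (1 - u) *: x.
have z0 : z 0 = x by rewrite /z scale0r add0r subr0 scale1r.
rewrite -{1}z0 => /segment_continuous/nbhs_ballP[r /= r0 rB].
pose u := Num.min (r / 2) 1.
have u0 : 0 < u by rewrite lt_min ltr01 divr_gt0.
have u1 : u <= 1 by rewrite ge_min lexx orbT.
have ur : u < r by rewrite gt_min; apply/orP; left; lra.
have u01 : 0 <= u <= 1 by rewrite u1 ltW.
exists (z u); split; last by apply: rB; rewrite /ball/= sub0r normrN gtr0_norm.
apply: superlevel_interior => //; first exact: cU.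
apply: lt_le_trans (cF _ _ _ Ux0 Ux u01).
have : 0 < u * (F x0 - t) by rewrite mulr_gt0// subr_gt0.
have : 0 <= (1 - u) * (F x - t) by rewrite mulr_ge0// subr_ge0.
lra.
Qed.

Lemma meval_ge0_closure (R : realType) (A : set 'rV[R]_2) (L : monomial R)
    (x : 'rV[R]_2) :
  (forall y, A y -> 0 <= meval L y) -> closure A x -> 0 <= meval L x.
Proof.
move=> LA clx; rewrite leNgt; apply/negP => Lx.
pose e := - meval L x / 2.
have e0 : 0 < e by rewrite divr_gt0// oppr_gt0.
have Lc : {for x, continuous (meval L)} by exact: meval_continuous.
have [y [/LA Ly]] := clx _ ((continuous_forP _ _).1 Lc _ e0).
by rewrite /= ler_norml /e => /andP[? _]; lra.
Qed.

Lemma convex_interior (R : realType) (A : set 'rV[R]_2) :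
  convex_set A -> convex_set A°.
Proof.
move=> /convex_setP cA; apply/convex_setP => x y s Ax Ay s01.
have [[r /= r0 rA] [q /= q0 qA]] : nbhs_ball x A /\ nbhs_ball y A.
  by split; apply/nbhs_ballP.
apply/nbhs_ballP; exists (Num.min r q); first by rewrite /= lt_min r0.
move=> w /ball_rV2P wz; set z := s *: x + (1 - s) *: y in wz.
have {}wz i : `|(z - w) 0 i| < Num.min r q.
  by rewrite mxE [X in _ + X]mxE; apply: wz; rewrite lt_min r0.
(* Translating both endpoints by one small vector translates the combination by it. *)
have -> : w = s *: (x - (z - w)) + (1 - s) *: (y - (z - w)).
  by apply/rowP => i; rewrite /z !mxE; ring.
apply: cA => //.
- apply: rA; apply/ball_rV2P => // i; rewrite 2!mxE opprB addrC subrK.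
  by have := wz i; rewrite lt_min => /andP[].
- apply: qA; apply/ball_rV2P => // i; rewrite 2!mxE opprB addrC subrK.
  by have := wz i; rewrite lt_min => /andP[].
Qed.

(** This adds the points of the superlevel set outside its interior: there F equals [t], and
    [L >= 0] is enough. *)
Lemma concave_le_noninterior (R : realType) (U : set 'rV[R]_2)
    (F : 'rV[R]_2 -> R) (t : R) (L : monomial R) (z x : 'rV[R]_2) :
  open U -> convex_set U -> tropical_series U F -> concave_function U F ->
  (forall x, superlevel U F t x -> 0 <= meval L x) ->
  U z -> t < F z -> meval L z <= F z - t ->
  U x -> ~ (superlevel U F t)° x -> F x <= t + meval L x.
Proof.
move=> oU cU FU cF L0 Uz tz Lz Ux nx.
have [Ft|tF] := ltP (F x) t.
  exact: (concave_le_outside cU cF L0 Uz tz Lz).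
have := L0 x (conj Ux tF).
have Ft : F x <= t.
  by rewrite leNgt; apply/negP => ?; apply: nx; exact: superlevel_interior.
lra.
Qed.

(* The monomials of G that stay below F - t somewhere are finitely many: they
   are at least -t on all of U, so that their gradients are bounded in terms of
   the distance from the superlevel set to the boundary of U. *)
Lemma relaxation_gluing (R : realType) (U P : set 'rV[R]_2)
    (F G : 'rV[R]_2 -> R) (t : R) (x0 : 'rV[R]_2) :
  let D := superlevel U F t in
  let H (x : 'rV[R]_2) := if x \in (D° : set 'rV[R]_2) then
    Num.min (F x) (t + G x) else F x in
  bounded_set U -> open U -> convex_set U ->
  zero_boundary_series U F -> concave_function U F ->
  0 < t -> U x0 -> t < F x0 -> P `<=` D° -> P `<=` corner_locus U F ->
  zero_boundary_series D° G -> P `<=` corner_locus D° G ->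
  zero_boundary_series U H /\ P `<=` corner_locus U H.
Proof.
move=> D H bU oU cU ZF cF t0 Ux0 tx0 PD PF ZG PG.
have [FU F0 _ _] := ZF; have [GD G0 _ _] := ZG.
have cD : compact D by exact: superlevel_compact.
have cG : concave_function D° G.
  apply: tropical_series_concave GD; apply: convex_interior.
  exact: superlevel_convex.
have DU : D `<=` U by move=> x [].
have DiD : D° `<=` D by exact: interior_subset.
have HD x : D° x -> H x = Num.min (F x) (t + G x).
  by move=> Dx; rewrite /H ifT// inE.
have HnD x : ~ D° x -> H x = F x.
  by move=> Dx; rewrite /H ifF//; apply/negP; rewrite inE.
(* Only monomials touching [G] strictly below [F - t] are kept: for them [concave_le_noninterior]
   shows that [t + L] does not cut into F outside [D°]. *)
pose S : set (monomial R) := [set L | supporting_monomial D° G L /\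
  exists2 z, D° z & meval L z = G z /\ G z < F z - t].
have SD L : S L -> forall x, D x -> 0 <= meval L x.
  move=> [[GL _] _] x Dx; apply: (@meval_ge0_closure _ D°).
    by move=> y Dy; apply: le_trans (GL _ Dy); exact: G0.
  exact: superlevel_closure_interior cF Ux0 tx0 _ Dx.
have SF L : S L -> forall x, U x -> ~ D° x -> F x <= t + meval L x.
  move=> SL x Ux nDx; have [_ [z Dz [Lz Gz]]] := SL.
  have tz : t < F z by have := G0 _ Dz; lra.
  apply: (concave_le_noninterior oU cU FU cF (SD _ SL) (DU _ (DiD _ Dz))) => //.
  by rewrite Lz ltW.
have SU L : S L -> forall x, U x -> - t <= meval L x.
  move=> SL x Ux; have [Dx|nDx] := pselect (D° x).
    by have := SD _ SL _ (DiD _ Dx); lra.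
  by have := SF _ SL _ Ux nDx; have := F0 _ Ux; lra.
have [b Fb] := superlevel_bounded_above bU oU ZF t0.
have [r r0 rD] := compact_uniform_ball oU cD DU.
have [Ms0 MsS] : exists Ms : seq (monomial R), forall L, L \in Ms <-> S L.
  (* At a touching point [z], [L z + t] is at most [F z <= b], while [L >= - t] on the ball of
     radius [r] around [z]. Supports of equal slope have equal constants, as each bounds [G] where
     the other touches. *)
  apply: (@finite_monomials _ _ (b / (r / 2))) => [L SL i|L M SL SM LM].
    rewrite ler_pdivlMr ?divr_gt0//.
    have [_ [z Dz [Lz Gz]]] := SL.
    apply: le_trans (_ : meval L z + t <= b).
      apply: meval_slope_bound r0 _ => y zy; apply: SU => //.
      exact: rD (DiD _ Dz) _ zy.
    have := Fb _ (DU _ (DiD _ Dz)); lra.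
  have le A B : S A -> S B -> A.1 = B.1 -> A.2 <= B.2.
    move=> [_ [z Dz [Az _]]] [[GB _] _] AB.
    by have := GB _ Dz; rewrite -Az /meval AB lerD2r.
  rewrite [L]surjective_pairing [M]surjective_pairing LM; congr pair.
  by apply/eqP; rewrite eq_le !le.
have [] := @glued_series _ U D F H (map (shift_monomial t) Ms0) oU ZF cF _ DU.
- by apply: compact_closed cD; exact: norm_hausdorff.
- by move=> x nDx; apply: HnD => /DiD.
- move=> x Ux; have [Dx|nDx] := pselect (D° x); last by rewrite HnD ?F0.
  by rewrite HD// le_min F0//= addr_ge0 ?G0 ?ltW.
- move=> x Ux; have [Dx|nDx] := pselect (D° x); last first.
    rewrite HnD//; split=> //; last by left.
    by move=> _ /mapP[L /MsS SL ->]; rewrite meval_shift; exact: SF.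
  rewrite HD//; split; first by rewrite ge_min lexx.
    move=> _ /mapP[L /MsS [[GL _] _] ->]; rewrite meval_shift ge_min.
    by rewrite lerD2l GL ?orbT.
  case: leP => [_|FG]; [by left|right].
  have [Ls [LsG /nbhs_singleton[[L LLs GL] _]]] :=
    tropical_series_active cG GD Dx.
  exists (shift_monomial t L); last by rewrite meval_shift GL.
  apply/map_f/MsS; split; first exact: (LsG _ LLs).1.
  by exists x => //; split=> //; lra.
move=> ZH _; split=> // p Pp.
have Dp := PD _ Pp.
have [_ [A [c [FA [m1 [m2 [m1A m2A m12 F1 F2]]]]]]] := PF _ Pp.
have [_ [B [d [GB [n1 [n2 [n1B n2B n12 G1 G2]]]]]]] := PG _ Pp.
pose LF := [seq (m, c m) | m <- A].
pose LG := map (shift_monomial t) [seq (m, d m) | m <- B].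
have HL : \forall y \near p, is_min_of (LF ++ LG) y (H y).
  near=> y; rewrite HD; last by near: y; exact: nbhs_interior.
  apply: is_min_of_cat; first by near: y.
  by apply: is_min_of_shift; near: y.
have Up := DU _ (DiD _ Dp).
(* Whichever of F and [t + G] realizes the minimum at [p] contributes its own two active monomials
   of distinct slopes. *)
have [Fp|Fp] := leP (F p) (t + G p).
  have Hp : H p = F p by rewrite HD//; exact: min_l.
  apply: (@corner_locus_of_list _ _ _ _ _ (m1, c m1) (m2, c m2) Up HL _ _ m12).
  - by rewrite mem_cat (map_f (fun m => (m, c m)) m1A).
  - by rewrite mem_cat (map_f (fun m => (m, c m)) m2A).
  - by rewrite Hp F1.
  - by rewrite Hp F2.
have Hp : H p = t + G p by rewrite HD//; apply: min_r; exact: ltW.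
apply: (@corner_locus_of_list _ _ _ _ _ (shift_monomial t (n1, d n1))
  (shift_monomial t (n2, d n2)) Up HL _ _ n12).
- by rewrite mem_cat !map_f ?orbT.
- by rewrite mem_cat !map_f ?orbT.
- by rewrite meval_shift Hp -G1.
- by rewrite meval_shift Hp -G2.
Unshelve. all: by end_near. Qed.

(** * The three parts of the theorem *)

(** The interior of [{F >= t / 2}] serves as neighborhood: the lower level leaves room around the
    superlevel set inside a compact subset of [U]. *)
Lemma superlevel_expansion (R : realType) (U : set 'rV[R]_2)
    (F : 'rV[R]_2 -> R) (t : R) :
  bounded_set U -> open U -> zero_boundary_series U F -> concave_function U F ->
  0 < t ->
  exists (V : set 'rV[R]_2) (Ls : seq (monomial R)),
    [/\ open V /\ superlevel U F t `<=` V,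
        compact (closure V) /\ closure V `<=` U,
        (forall L, L \in Ls -> supporting_monomial U F L) &
        (forall x, V x -> is_min_of Ls x (F x))].
Proof.
move=> bU oU ZF cF t0; have [FU _ _ _] := ZF.
have t20 : 0 < t / 2 by rewrite divr_gt0.
have cK := superlevel_compact bU oU ZF t20.
have KU : superlevel U F (t / 2) `<=` U by move=> x [].
have [Ls [LsS LsF]] := compact_supporting cF FU cK KU.
have clK : closed (superlevel U F (t / 2)).
  by apply: compact_closed cK; exact: norm_hausdorff.
have clV : closure (superlevel U F (t / 2))° `<=` superlevel U F (t / 2).
  move=> x /(closure_subset (@interior_subset _ _)).
  by rewrite -(closure_id _).1.
exists (superlevel U F (t / 2))°, Ls; split=> //.
- split; first exact: open_interior.
  by move=> x [Ux tx]; apply: superlevel_interior => //; lra.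
- split; last exact: subset_trans clV KU.
  exact: subclosed_compact (@closed_closure _ _) cK clV.
- by move=> x /interior_subset; exact: LsF.
Qed.

Lemma polynomial_gluing (R : realType) (U : set 'rV[R]_2)
    (F G : 'rV[R]_2 -> R) (t : R) :
  let D := superlevel U F t in
  bounded_set U -> open U -> convex_set U ->
  zero_boundary_series U F -> concave_function U F -> 0 < t ->
  zero_boundary_polynomial D G -> (forall x, D x -> G x <= F x - t) ->
  zero_boundary_series U (core_gluing D t F G) /\
  concave_function U (core_gluing D t F G).
Proof.
move=> D bU oU cU ZF cF t0 [G0 _ [Ls LsG]] GF; have [FU F0 _ _] := ZF.
set H := core_gluing D t F G.
have HD x : D x -> H x = t + G x.
  by move=> Dx; rewrite /H /core_gluing ifT// inE.
have HnD x : ~ D x -> H x = F x.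
  by move=> nDx; rewrite /H /core_gluing ifF//; apply/negP; rewrite inE.
(* The other monomials of [Ls] may drop below [F - t] outside [D], and they are dispensable inside,
   where F takes over. *)
pose touches (L : monomial R) :=
  exists2 z, D z & meval L z = G z /\ G z < F z - t.
pose Ms := [seq shift_monomial t L | L <- Ls & `[< touches L >]].
apply: (@glued_series _ U D F H Ms) => //.
- apply: compact_closed (superlevel_compact bU oU ZF t0).
  exact: norm_hausdorff.
- by move=> x [].
- move=> x Ux; have [Dx|nDx] := pselect (D x); last by rewrite HnD ?F0.
  by rewrite HD// addr_ge0 ?G0 ?ltW.
move=> x Ux; have [Dx|nDx] := pselect (D x).
  rewrite HD//; have GFx := GF _ Dx; split; first by lra.
    move=> _ /mapP[L + ->]; rewrite mem_filter => /andP[_ LLs].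
    by rewrite meval_shift lerD2l; exact: (LsG _ Dx).2.
  have [GFx'|FGx] := ltP (G x) (F x - t); last by left; lra.
  have [[L LLs GL] _] := LsG _ Dx.
  right; exists (shift_monomial t L); last by rewrite meval_shift GL.
  rewrite map_f// mem_filter LLs andbT; apply/asboolP.
  by exists x.
rewrite HnD//; split=> //; last by left.
move=> _ /mapP[L + ->]; rewrite mem_filter => /andP[/asboolP[z Dz [Lz Gz]] LLs].
rewrite meval_shift.
have L0 y : D y -> 0 <= meval L y.
  by move=> Dy; apply: le_trans (G0 _ Dy) _; exact: (LsG _ Dy).2.
have tz : t < F z by have := G0 _ Dz; lra.
apply: (concave_le_outside cU cF L0 Dz.1 tz) => //; first by rewrite Lz ltW.
by rewrite ltNge; apply/negP => ?; apply: nDx.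
Qed.

Lemma superlevel_polynomial (R : realType) (U : set 'rV[R]_2)
    (F : 'rV[R]_2 -> R) (t : R) :
  bounded_set U -> open U -> zero_boundary_series U F -> concave_function U F ->
  0 < t -> zero_boundary_polynomial (superlevel U F t) (fun x => F x - t).
Proof.
move=> bU oU ZF cF t0; have [FU _ _ _] := ZF.
have cD := superlevel_compact bU oU ZF t0.
split=> [x [_ tx]|x [clx nx]|]; first by rewrite subr_ge0.
  have [Ux tx] : superlevel U F t x.
    by move: clx; rewrite -(closure_id _).1//; apply: compact_closed cD;
      exact: norm_hausdorff.
  apply/eqP; rewrite subr_eq0 eq_le tx andbT leNgt; apply/negP => tF.
  by apply: nx; exact: superlevel_interior.
have [V [Ls [[_ DV] _ _ VLs]]] := superlevel_expansion bU oU ZF cF t0.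
exists (map (shift_monomial (- t)) Ls) => x /DV/VLs.
by rewrite addrC; exact: is_min_of_shift.
Qed.

(** [F - t] is a competitor on the core, which bounds the relaxation there from above. *)
Lemma superlevel_shift_series (R : realType) (U P : set 'rV[R]_2)
    (F : 'rV[R]_2 -> R) (t : R) :
  let D := superlevel U F t in
  bounded_set U -> open U -> zero_boundary_series U F -> 0 < t ->
  P `<=` D° -> P `<=` corner_locus U F ->
  zero_boundary_series D° (fun x => F x - t) /\
  P `<=` corner_locus D° (fun x => F x - t).
Proof.
move=> D bU oU ZF t0 PD PF; have [FU F0 _ _] := ZF.
have DU : D `<=` U by move=> x [].
have shift A c x : local_expansion F x A c -> \forall y \near x,
    is_min_of (map (shift_monomial (- t)) [seq (m, c m) | m <- A]) y (F y - t).
  by apply: filterS => y /is_min_of_shift; rewrite addrC.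
have clD : closure D° `<=` D.
  move=> x /(closure_subset (@interior_subset _ _)).
  rewrite -(closure_id _).1//.
  apply: compact_closed (superlevel_compact bU oU ZF t0).
  exact: norm_hausdorff.
have SD : tropical_series D° (fun x => F x - t).
  move=> x /interior_subset/DU/FU[A [c /shift]]; exact: local_expansion_of_list.
split; last first.
  move=> p Pp.
  have [_ [A [c [/shift FA [m1 [m2 [m1A m2A m12 F1 F2]]]]]]] := PF _ Pp.
  apply: (@corner_locus_of_list _ _ _ _ _ (shift_monomial (- t) (m1, c m1))
    (shift_monomial (- t) (m2, c m2)) (PD _ Pp) FA _ _ m12).
  - by rewrite !map_f.
  - by rewrite !map_f.
  - by rewrite meval_shift -F1 addrC.
  - by rewrite meval_shift -F2 addrC.
split=> //.
- by move=> x /interior_subset[_ tx]; rewrite subr_ge0.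
- apply: continuous_in_subspaceT => x /set_mem/clD/DU/FU[A [c /shift]].
  exact: is_min_of_continuous.
- move=> x [/clD[Ux tx]];
  rewrite ((interior_id _).1 (@open_interior _ D)) => nx.
  apply/eqP; rewrite subr_eq0 eq_le tx andbT leNgt; apply/negP => tF.
  by apply: nx; exact: superlevel_interior.
Qed.

(** For the lower bound, each competitor [G] on the core yields the competitor [Num.min F (t + G)],
    extended by F, on [U]. By minimality F lies below it, hence below [t + G] on the interior of the
    core. *)
Lemma relaxation_superlevel (R : realType) (U P : set 'rV[R]_2)
    (F : 'rV[R]_2 -> R) (t : R) (x0 : 'rV[R]_2) :
  let D := superlevel U F t in
  bounded_set U -> open U -> convex_set U ->
  zero_boundary_series U F -> concave_function U F ->
  (forall x, U x -> (F x)%:E = relaxation U P x) ->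
  0 < t -> U x0 -> t < F x0 -> P `<=` D° -> P `<=` corner_locus U F ->
  forall x, D x -> relaxation D° P x = (F x - t)%:E.
Proof.
move=> D bU oU cU ZF cF Frel t0 Ux0 tx0 PD PF x Dx; have [FU _ _ _] := ZF.
apply/eqP; rewrite eq_le; apply/andP; split.
  apply: ereal_inf_lbound; exists (fun x => F x - t) => //.
  exact: superlevel_shift_series.
apply: le_ereal_inf_tmp => _ [G [ZG PG] <-]; rewrite lee_fin.
(* Off the interior, [x] is a boundary point of [D°], so [G x = 0], and [F x] cannot exceed [t]. *)
have [Dix|nDix] := pselect (D° x); last first.
  have [_ _ _ ->] := ZG; last first.
    split; last by rewrite ((interior_id _).1 (@open_interior _ D)).
    exact: superlevel_closure_interior cF Ux0 tx0 _ Dx.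
  rewrite subr_le0 leNgt; apply/negP => tF; apply: nDix.
  exact: superlevel_interior Dx.1 tF.
have [ZH PH] := relaxation_gluing bU oU cU ZF cF t0 Ux0 tx0 PD PF ZG PG.
have : (relaxation U P x <= (Num.min (F x) (t + G x))%:E)%E.
  apply: ereal_inf_lbound; exists
    (fun y => if y \in (D° : set 'rV[R]_2) then
      Num.min (F y) (t + G y) else F y) => //.
  by rewrite ifT// inE.
by rewrite -Frel ?lee_fin ?le_min; [move=> /andP[_]; lra|exact: Dx.1].
Qed.

Theorem theorem9p8 (R : realType) (Omega : set 'rV[R]_2) (F : 'rV[R]_2 -> R)
    (Omega_bounded : bounded_set Omega)
    (Omega_open : open Omega)
    (Omega_convex : convex_set Omega)
    (Omega_interior : Omega° !=set0)
    (F_series : zero_boundary_series Omega F)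
    (F_concave : concave_function Omega F) :
  (forall t : R, 0 < t -> t < sup (F @` closure Omega) ->
    let Delta := superlevel Omega F t in
    (* (i) *)
    ([/\ compact Delta, convex_set Delta, rational_slopes Delta &
         Delta° !=set0] /\
     (exists (U : set 'rV[R]_2) (Ls : seq (monomial R)),
       [/\ open U /\ Delta `<=` U,
           compact (closure U) /\ closure U `<=` Omega,
           (forall L, L \in Ls -> supporting_monomial Omega F L) &
           (forall x, U x -> is_min_of Ls x (F x))]) /\
     zero_boundary_polynomial Delta (fun x => F x - t)) /\
    (* (ii) *)
    (forall G : 'rV[R]_2 -> R,
      zero_boundary_polynomial Delta G ->
      (forall x, Delta x -> G x <= F x - t) ->
      zero_boundary_series Omega (core_gluing Delta t F G) /\
      concave_function Omega (core_gluing Delta t F G))) /\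
  (* (iii) *)
  (forall P C : set 'rV[R]_2,
    finite_set P -> P !=set0 -> P `<=` Omega ->
    (forall x, Omega x -> (F x)%:E = relaxation Omega P x) ->
    compact C -> C `<=` Omega ->
    (forall x, Omega x -> 0 < F x) /\
    (forall t : R, 0 < t -> t < inf (F @` (C `|` P)) ->
      let Delta := superlevel Omega F t in
      C `|` P `<=` Delta° /\
      (forall x, Delta x -> (F x)%:E = (t%:E + relaxation Delta° P x)%E))).
Proof.
have [FU F0 _ Fbd] := F_series.
split=> [t t0 tsup Delta|P C _ [p Pp] PO Frel _ CO].
  (* The supremum runs over the closure, but boundary values are zero, so a value above [t] occurs
     inside [Omega]. *)
  have [x0 Ox0 tx0] : exists2 x0, Omega x0 & t < F x0.
    apply: contrapT => nt; move: tsup; apply/negP; rewrite -leNgt.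
    apply: ge_sup.
      have [z /interior_subset Oz] := Omega_interior.
      by exists (F z), z => //; exact: subset_closure.
    move=> _ [y cly <-]; have [Oy|nOy] := pselect (Omega y).
      by rewrite leNgt; apply/negP => ?; apply: nt; exists y.
    by rewrite Fbd; [exact: ltW|split=> // /interior_subset].
  split; first (split; last split).
  - split; first exact: superlevel_compact.
    + exact: superlevel_convex.
    + exact: superlevel_rational Ox0 tx0.
    + by exists x0; exact: superlevel_interior.
  - exact: superlevel_expansion.
  - exact: superlevel_polynomial.
  - by move=> G; exact: polynomial_gluing.
have PF : P `<=` corner_locus Omega F by exact: relaxation_corner_locus.
have Fp : 0 < F p by apply: corner_locus_gt0 (PF _ Pp).
split=> [|t t0 tinf Delta]; first
  exact: (concave_gt0 Omega_open F_concave F0 (PO _ Pp) Fp).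
have tF x : (C `|` P) x -> Omega x /\ t < F x.
  move=> CPx; have Ox : Omega x by case: CPx => [/CO|/PO].
  split=> //; apply: lt_le_trans tinf _; apply: ge_inf; last by exists x.
  by exists 0 => _ [y [/CO|/PO] Oy <-]; exact: F0.
have CPD : C `|` P `<=` Delta°.
  by move=> x /tF[Ox tx]; exact: superlevel_interior.
split=> // x Dx; have [Op tp] := tF p (or_intror Pp).
rewrite (relaxation_superlevel _ _ _ _ _ Frel t0 Op tp) => // [|y Py].
  by rewrite -EFinD addrC subrK.
by apply: CPD; right.
Qed.
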